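(* Let $\kappa$ be an infinite cardinal with $\kappa^{<\kappa}=\kappa$, and let $\varphi$ be a weakly $\kappa$-scattered linear order type of size at most $\kappa$. Then there is a weakly $\kappa$-scattered linear order type $\tau$ of size at most $\kappa$ such that, for all $n<\omega$, $\tau\longrightarrow(\varphi,n)^2$.
   Context: A linear order $P$ (and its order type) is $\kappa$-saturated if $P\neq\emptyset$ and, for all $A,B\subseteq P$ (one or both possibly empty) with $|A|,|B|<\kappa$ and $A<_P B$ (i.e. $a<_P b$ for all $a\in A$, $b\in B$), there is $c\in P$ with $A<_P c<_P B$. For infinite regular $\kappa$, a linear order (type) is weakly $\kappa$-scattered if it has no $\kappa$-saturated suborder. The size of an order type is the cardinality of any order of that type. For linear order types $\tau,\varphi$ and $n<\omega$, $\tau\longrightarrow(\varphi,n)^2$ means: whenever $P$ is a linear order of type $\tau$ and $f:[P]^2\to\{0,1\}$ (where $[P]^2$ is the set of two-element subsets of $P$), either there is a suborder $Q\subseteq P$ of type $\varphi$ with $f$ constantly $0$ on $[Q]^2$, or there is $Q\subseteq P$ with $n$ elements with $f$ constantly $1$ on $[Q]^2$. *)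

(* Defs.v *)
From mathcomp Require Import all_boot all_order.
From mathcomp Require Import boolp classical_sets functions cardinality.

Set Implicit Arguments.
Unset Strict Implicit.
Unset Printing Implicit Defensive.

Import Order.TTheory.

Local Open Scope classical_set_scope.
Local Open Scope card_scope.
Local Open Scope order_scope.

(* A cardinal is represented by a type, or a set, of that cardinality.
   Order types are represented by linear orders; under the classical axioms
   of boolp every linear order on a type can be given by an orderType. *)

Definition card_lt T U (A : set T) (B : set U) : Prop :=
  (A #<= B) /\ ~ (B #<= A).

(* |M| = kappa^{<kappa}, the supremum of kappa^lambda over all cardinals
   lambda < kappa, where kappa = |K|. *)
Definition is_weak_power (K M : Type) : Prop :=
  (forall L : Type, card_lt [set: L] [set: K] ->
     [set: L -> K] #<= [set: M]) /\
  (forall N : Type,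
     (forall L : Type, card_lt [set: L] [set: K] ->
        [set: L -> K] #<= [set: N]) ->
     [set: M] #<= [set: N]).

(* The suborder of T with underlying set P is |K|-saturated. *)
Definition saturated (K : Type) d (T : orderType d) (P : set T) : Prop :=
  P !=set0 /\
  forall A B : set T, A `<=` P -> B `<=` P ->
    card_lt A [set: K] -> card_lt B [set: K] ->
    (forall a b, A a -> B b -> a < b) ->
    exists c, [/\ P c, forall a, A a -> a < c & forall b, B b -> c < b].

Definition weakly_scattered (K : Type) d (T : orderType d) : Prop :=
  ~ exists P : set T, saturated K P.

(* The suborder of T with underlying set Q has the order type of F. *)
Definition has_order_type d (T : orderType d) d' (F : orderType d')
    (Q : set T) : Prop :=
  exists g : F -> T, set_bij [set: F] Q g /\ {mono g : x y / x < y}.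

(* [T]^2 *)
Definition pairs (T : Type) : Type := {p : set T | p #= `I_2}.

(* The pairs in [Q]^2, as a subset of [P]^2, are those included in Q. *)
Definition homogeneous (T : Type) (f : pairs T -> bool) (Q : set T)
    (i : bool) : Prop :=
  forall p : pairs T, sval p `<=` Q -> f p = i.

(* T --> (F, n)^2, with the colours 0 and 1 encoded as false and true. *)
Definition arrow d (T : orderType d) d' (F : orderType d') (n : nat) : Prop :=
  forall (d0 : Order.disp_t) (P : orderType d0),
    has_order_type T [set: P] ->
  forall f : pairs P -> bool,
    (exists Q : set P, has_order_type F Q /\ homogeneous f Q false) \/
    (exists Q : set P, Q #= `I_n /\ homogeneous f Q true).

(* Main.v *)
(* Given H = T_n with H --> (F, n)^2 and F embedded in H, number H injectively by
   a well-order W all of whose proper initial segments have size < kappa, and let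
   T_(n+1) be the sum over h in H of the lexicographic powers H^(W_{< h}).
   Colour [T_(n+1)]^2. If the 1-neighbours A_x of some x contain a copy of H, one
   vertex is gained. Otherwise every A_x misses, at each node of each power, the
   cone over one of the children of that node. Choosing points z_h in the summands
   recursively along W, the W_{< h} many steps of the branch z_h are exactly
   enough to avoid all the A_(z_k) with k before h, so the z_h form a
   0-homogeneous copy of H.
   T_(n+1) is weakly kappa-scattered because a saturated subset of a power of
   length < kappa would yield nested intervals on which one more coordinate is
   constant at each step, ending in a saturated set with one point.
   Finally T is the sum of the T_n over n in nat. *)
From Stdlib Require Import Inverse_Image.
From HB Require Import structures.
Require Import Defs.
From mathcomp Require Import all_boot all_order.
From mathcomp Require Import boolp classical_sets functions cardinality wochoice.

Set Implicit Arguments.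
Unset Strict Implicit.
Unset Printing Implicit Defensive.

Import Order.TTheory.

Local Open Scope classical_set_scope.
Local Open Scope card_scope.
Local Open Scope order_scope.

(** * Cardinal comparisons *)

Lemma inj_card_leT T U (f : T -> U) : injective f -> [set: T] #<= [set: U].
Proof.
move=> fI; have /card_eqPle[_ le1] : f @` setT #= [set: T].
  by apply: inj_card_eq => x y _ _; exact: fI.
exact: card_le_trans le1 (subset_card_le (@subsetT _ _)).
Qed.

Lemma card_leT_inj T U :
  [set: T] #<= [set: U] -> exists f : T -> U, injective f.
Proof.
move=> /card_leP[f]; exists (fun x => val (f (SigSub (in_setT x)))).
by move=> x y /val_inj /inj; rewrite !in_setT => /(_ erefl erefl) [].
Qed.

Lemma card_le_lt_trans T U V (A : set T) (B : set U) (C : set V) :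
  A #<= B -> card_lt B C -> card_lt A C.
Proof.
move=> AB [BC nCB]; split; first exact: card_le_trans AB BC.
by move=> CA; apply: nCB; exact: card_le_trans CA AB.
Qed.

Lemma card_lt_image T U V (f : T -> U) (A : set T) (C : set V) :
  card_lt A C -> card_lt (f @` A) C.
Proof. exact/card_le_lt_trans/card_image_le. Qed.

Lemma finite_card_lt T U (A : set T) (B : set U) :
  finite_set A -> infinite_set B -> card_lt A B.
Proof.
move=> finA infB; split; last by move=> /card_le_finite/(_ finA).
have [n /card_eqPle[An _]] := finA.
apply: card_le_trans An _; apply: card_le_trans (subset_card_le (@subsetT _ _)) _.
exact/infiniteP.
Qed.

(** * Suborders, transfinite recursion and well-orders *)

Definition suborder d (T : orderType d) (P : pred T) : Type := {x : T | P x}.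
HB.instance Definition _ d (T : orderType d) (P : pred T) :=
  SubChoice.on (suborder P).
HB.instance Definition _ d (T : orderType d) (P : pred T) :=
  [SubChoice_isSubOrder of suborder P by <: with d].

Lemma suborder_wf d (T : orderType d) (P : pred T) :
  well_founded (fun x y : T => x < y) ->
  well_founded (fun x y : suborder P => x < y).
Proof. by move=> wfT; apply: (@wf_inverse_image (suborder P) T _ val wfT). Qed.

Lemma card_lt_sig T U (P : pred T) (A : set U) :
  card_lt [set x | P x] A -> card_lt [set: {x | P x}] A.
Proof.
apply: card_le_lt_trans.
have /card_eqPle[_ le1] : (@sval T P) @` setT #= [set: {x | P x}].
  by apply: inj_card_eq => x y _ _; exact: val_inj.
by apply: card_le_trans le1 (subset_card_le _) => _ [[x Px] _ <-].
Qed.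

(** Well-founded recursion that picks a witness at each stage. As [Q i] reads [g] only below [i], it
    can be stated for total functions. *)
Lemma transfinite_choice (I U : Type) (R : I -> I -> Prop)
    (Q : I -> (I -> U) -> U -> Prop) (u0 : U) :
  well_founded R ->
  (forall i g g' u, (forall j, R j i -> g j = g' j) -> Q i g u -> Q i g' u) ->
  (forall i g, (forall j, R j i -> Q j g (g j)) -> exists u, Q i g u) ->
  exists g, forall i, Q i g (g i).
Proof.
move=> wfR Qloc Qex.
(* The values known at stage [i] are padded with [u0]; by locality [Q] does not see the padding. *)
pose ext i (r : forall j, R j i -> U) j :=
  if pselect (R j i) is left p then r j p else u0.
pose step i (r : forall j, R j i -> U) :=
  if pselect (exists u, Q i (ext i r) u) is left e then projT1 (cid e) else u0.
pose g := Fix wfR (fun=> U) step.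
have gE i : g i = step i (fun j _ => g j).
  rewrite /g Fix_eq // => {}i r r' rr'; congr (step _ _).
  by apply: functional_extensionality_dep => j; apply: functional_extensionality_dep.
have extE i j : R j i -> ext i (fun j _ => g j) j = g j.
  by rewrite /ext; case: pselect.
exists g; elim/(well_founded_ind wfR) => i IH.
have [u Qu] := Qex i g IH.
have gext j : R j i -> ext i (fun j _ => g j) j = g j by exact: extE.
rewrite gE /step; case: pselect => [e|[]].
  by case: cid => v /=; exact: Qloc.
by exists u; apply: Qloc Qu => j /gext.
Qed.

Lemma well_order_type (T : Type) :
  exists (d : Order.disp_t) (W : orderType d),
    well_founded (fun v w : W => v < w) /\ [set: T] #= [set: W].
Proof.
pose C : choiceType := HB.pack T (gen_eqMixin T) (gen_choiceMixin T).
have [R Rwo] := well_ordering_principle C.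
have Rmin (A : {pred C}) x : x \in A -> exists2 z, z \in A & {in A, forall y, R z y}.
  by move=> Ax; have [|z [[Az zmin] _]] := Rwo A; [exists x | exists z].
(* The order axioms come from least elements of sets of two or three points, antisymmetry from their
   uniqueness. *)
have Rtot : total R.
  move=> x y; have [|z] := Rmin (pred2 x y) x; rewrite inE ?eqxx //.
  by move=> /orP[] /eqP -> zmin;
    rewrite ?(zmin y) ?(zmin x) ?orbT // !inE eqxx ?orbT.
have Rxx : reflexive R by move=> x; have := Rtot x x; rewrite orbb.
have Ranti : antisymmetric R.
  move=> x y /andP[Rxy Ryx].
  have [|z [_ zuniq]] := Rwo (pred2 x y); first by exists x; rewrite inE eqxx.
  have zE u : u = x \/ u = y -> z = u.
    move=> uxy; apply: zuniq; split.
      by case: uxy => ->; rewrite inE eqxx ?orbT.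
    by move=> v; rewrite inE => /orP[] /eqP ->; case: uxy => ->.
  by rewrite -(zE x) ?(zE y) //; [right | left].
have Rtrans : transitive R.
  move=> y x z Rxy Ryz.
  have [|u] := Rmin (mem [:: x; y; z]) x; rewrite ?inE ?eqxx //.
  move=> /or3P[] /eqP -> umin; first by rewrite umin // !inE eqxx !orbT.
    have -> : x = y by apply: Ranti; rewrite Rxy umin // !inE eqxx.
    by [].
  have -> : z = y by apply: Ranti; rewrite Ryz umin // !inE eqxx !orbT.
  by [].
pose P : porderType (Order.Disp tt tt) :=
  HB.pack C (Order.Le_isPOrder.Build (Order.Disp tt tt) C Rxx Ranti Rtrans).
pose W : orderType (Order.Disp tt tt) :=
  HB.pack P (Order.POrder_isTotal.Build (Order.Disp tt tt) P Rtot).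
exists (Order.Disp tt tt), W; split; last exact: card_eqxx.
move=> x; apply: contrapT => nAx.
have [|z] := Rmin (fun y : C => `[< ~ Acc (fun v w : W => v < w) y >]) x.
  exact/asboolP.
move=> /asboolP nAz zmin; apply: nAz; constructor => y yz.
apply: contrapT => nAy.
have : z <= y :> W by apply: zmin; apply/asboolP.
by rewrite leNgt yz.
Qed.

(** Well-order [K] and keep the points whose initial segment is too small to contain a copy of [K].
    If some point is dropped, the segment below the first dropped one is kept entirely and has size
    at least that of [K]. *)
Lemma initial_well_order (K : Type) :
  exists (d : Order.disp_t) (W : orderType d),
    [/\ well_founded (fun v w : W => v < w), [set: K] #<= [set: W] &
        forall w : W, card_lt [set v : W | v < w] [set: K]].
Proof.
have [d [W [wfW /card_eqPle[leKW leWK]]]] := well_order_type K.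
pose S (w : W) := `[< ~ ([set: K] #<= [set v : W | v < w]) >].
exists d, (suborder S : orderType d); split; first exact: suborder_wf.
  case: (pselect (exists w, ~ S w)) => [[w0]|allS].
    elim/(well_founded_ind wfW): w0 => w IH nSw.
    have [[v vw nSv]|nS] := pselect (exists2 v, v < w & ~ S v).
      exact: IH vw nSv.
    have segS v : v < w -> S v.
      by move=> vw; apply: contrapT => nSv; apply: nS; exists v.
    have leKw : [set: K] #<= [set v : W | v < w].
      by apply: contrapT => nle; apply: nSw; exact/asboolP.
    apply: card_le_trans leKw _.
    have -> : [set v : W | v < w] = sval @` [set v : suborder S | sval v < w].
      apply/seteqP; split => [v vw|_ [v vw <-] //].
      by exists (exist _ v (segS v vw)).
    exact: card_le_trans (card_image_le _ _) (subset_card_le (@subsetT _ _)).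
  apply: card_le_trans leKW _.
  have Sall w : S w by apply: contrapT => nSw; apply: allS; exists w.
  by apply: (@inj_card_leT _ _ (fun w => exist _ w (Sall w))) => x y [].
move=> [w Sw]; have /asboolP nle := Sw.
have le1 : [set v : suborder S | v < exist _ w Sw] #<= [set v : W | v < w].
  have /card_eqPle[_ le1] := @inj_card_eq _ _ [set v : suborder S | v < exist _ w Sw]
    sval (fun x y _ _ => @val_inj _ _ _ x y).
  by apply: card_le_trans le1 (subset_card_le _) => _ [v vw <-].
split; last by move=> leK; apply: nle; exact: card_le_trans leK le1.
apply: card_le_trans le1 _.
exact: card_le_trans (subset_card_le (@subsetT _ _)) leWK.
Qed.

(** * Lexicographic powers with a well-founded index *)

Section lexfun.
Context (di dh : Order.disp_t) (I : orderType di) (H : orderType dh).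

(* The proof [wfI] is a parameter of the type because the lexicographic order
   is total only for a well-founded index. *)
Definition lexfun (wfI : well_founded (fun i j : I => i < j)) : Type := I -> H.

Context (wfI : well_founded (fun i j : I => i < j)).
Implicit Types x y z : lexfun wfI.

Definition lexfun_lt x y : bool :=
  `[< exists i, (forall j, j < i -> x j = y j) /\ x i < y i >].

Lemma lexfun_lt_irr : irreflexive lexfun_lt.
Proof. by move=> x; apply/asboolP => -[i [_]]; rewrite ltxx. Qed.

Lemma lexfun_lt_trans : transitive lexfun_lt.
Proof.
move=> y x z /asboolP[i [xyi xy]] /asboolP[j [yzj yz]]; apply/asboolP.
have [ij|ji|ij] := ltgtP i j.
- exists i; split=> [k ki|]; last by rewrite -yzj.
  by rewrite xyi // yzj // (lt_trans ki).
- exists j; split=> [k kj|]; last by rewrite xyi.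
  by rewrite xyi ?yzj // (lt_trans kj).
- exists i; subst j; split=> [k ki|]; last exact: lt_trans xy yz.
  by rewrite xyi // yzj.
Qed.

Lemma lexfun_lt_total x y :
  x != y :> {eclassic I -> H} -> lexfun_lt x y || lexfun_lt y x.
Proof.
move=> /eqP xy; have [i nxy] : exists i, x i <> y i.
  apply: contrapT => nex; apply: xy; apply/funext => i.
  by apply: contrapT => ?; apply: nex; exists i.
elim/(well_founded_ind wfI): i nxy => i IH /eqP xyi.
have [[j [ji /IH]]|nex] := pselect (exists j, j < i /\ x j <> y j); first exact.
have xyj j : j < i -> x j = y j.
  by move=> ji; apply: contrapT => ?; apply: nex; exists j.
move: xyi; rewrite neq_lt => /orP[] lti; apply/orP; [left|right];
  by apply/asboolP; exists i => //; split=> // j /xyj.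
Qed.

HB.instance Definition _ := gen_eqMixin (lexfun wfI).
HB.instance Definition _ := gen_choiceMixin (lexfun wfI).
HB.instance Definition _ :=
  Order.Lt_isPOrder.Build dh (lexfun wfI) lexfun_lt_irr lexfun_lt_trans.

Lemma lexfun_le_total : total (<=%O : rel (lexfun wfI)).
Proof.
move=> x y; have [->|xy] := eqVneq x y; first by rewrite lexx.
by have /orP[/ltW->|/ltW->] : (x < y) || (y < x) := lexfun_lt_total xy;
  rewrite ?orbT.
Qed.

HB.instance Definition _ :=
  Order.POrder_isTotal.Build dh (lexfun wfI) lexfun_le_total.

Lemma lexfun_ltP x y :
  reflect (exists i, (forall j, j < i -> x j = y j) /\ x i < y i) (x < y).
Proof. exact: asboolP. Qed.

Lemma lexfun_lt_coord x y i : (forall j, j < i -> x j = y j) -> x < y -> x i <= y i.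
Proof.
move=> xyi /lexfun_ltP[j [xyj xy]]; have [ij|ji|ij] := ltgtP i j.
- by rewrite xyj.
- by move: xy; rewrite xyi // ltxx.
- by rewrite ij ltW.
Qed.

(** Once [z] agrees with both ends below [j], its value at [j] is squeezed between two equal
    values. *)
Lemma lexfun_sandwich x y z i :
  x < z -> z < y -> (forall j, j <= i -> x j = y j) -> forall j, j <= i -> z j = x j.
Proof.
move=> xz zy xyi; elim/(well_founded_ind wfI) => j IH ji.
have zx k : k < j -> z k = x k.
  by move=> kj; apply: IH => //; exact: le_trans (ltW kj) ji.
apply/le_anti/andP; split; last by apply: lexfun_lt_coord xz => k /zx.
rewrite xyi //; apply: lexfun_lt_coord zy => k kj.
by rewrite zx // xyi // (le_trans (ltW kj)).
Qed.

End lexfun.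

(** * Saturated sets, and weak scatteredness of sums and powers *)

Section saturated.
Context (K : Type) (K_infinite : infinite_set [set: K]).

(** Since [phi] is injective on [P], small subsets of the image pull back to small subsets of [P],
    where the gap can be filled. *)
Lemma saturated_image d (T : orderType d) d' (H : orderType d') (P : set T)
    (phi : T -> H) :
  (forall x y, P x -> P y -> x < y -> phi x < phi y) ->
  saturated K P -> saturated K (phi @` P).
Proof.
move=> phiP [[x0 Px0] satP]; split=> [|A B AP BP ltA ltB AB].
  by exists (phi x0), x0.
have phiI : {in P &, injective phi}.
  move=> x y /set_mem Px /set_mem Py eqphi.
  case: (ltgtP x y) => // [/(phiP _ _ Px Py)|/(phiP _ _ Py Px)];
    by rewrite eqphi ltxx.
have card C : C `<=` phi @` P -> card_lt C [set: K] ->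
    card_lt (P `&` phi @^-1` C) [set: K].
  move=> CP; apply: card_le_lt_trans.
  have /card_eqPle[_ le1] : phi @` (P `&` phi @^-1` C) #= P `&` phi @^-1` C.
    apply: inj_card_eq => x y /set_mem[Px _] /set_mem[Py _].
    by apply: phiI; exact/mem_set.
  by apply: card_le_trans le1 (subset_card_le _) => _ [x [_ Cx] <-].
have [|c [Pc Ac Bc]] := satP _ _ (@subIsetl _ P (phi @^-1` A))
    (@subIsetl _ P (phi @^-1` B)) (card A AP ltA) (card B BP ltB).
  move=> a b [Pa Aa] [Pb Bb]; have := AB _ _ Aa Bb.
  case: (ltgtP a b) => [//|/phiP|->]; last by rewrite ltxx.
  by move=> /(_ Pb Pa) /lt_trans /[apply]; rewrite ltxx.
exists (phi c); split; first by exists c.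
  by move=> a /[dup] /AP [x Px <-] Ax; apply: phiP => //; exact: Ac.
by move=> b /[dup] /BP [x Px <-] Bx; apply: phiP => //; exact: Bc.
Qed.

Lemma saturated_gap d (T : orderType d) (P A B : set T) :
  saturated K P -> A `<=` P -> B `<=` P ->
  card_lt A [set: K] -> card_lt B [set: K] ->
  (forall a b, A a -> B b -> a < b) ->
  saturated K [set c | [/\ P c, forall a, A a -> a < c & forall b, B b -> c < b]].
Proof.
move=> [P0 satP] AP BP ltA ltB AB; split; first exact: satP.
move=> C D CP DP ltC ltD CD.
(* Only the innermost bounds matter, so no union of small sets is needed. *)
pose A' := if pselect (C !=set0) then C else A.
pose B' := if pselect (D !=set0) then D else B.
have [|||||c [Pc A'c B'c]] := satP A' B'.
- by rewrite /A'; case: pselect => // _ x /CP[].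
- by rewrite /B'; case: pselect => // _ x /DP[].
- by rewrite /A'; case: pselect.
- by rewrite /B'; case: pselect.
- rewrite /A' /B'; case: pselect => ?; case: pselect => ? /=.
  + exact: CD.
  + by move=> a b Ca Bb; have [_ _] := CP _ Ca; apply.
  + by move=> a b Aa Db; have [_ + _] := DP _ Db; apply.
  + exact: AB.
have Cc a : C a -> a < c.
  by move=> Ca; apply: A'c; rewrite /A'; case: pselect => // -[]; exists a.
have Dc b : D b -> c < b.
  by move=> Db; apply: B'c; rewrite /B'; case: pselect => // -[]; exists b.
exists c; split=> //; split=> // x.
  move: A'c; rewrite /A'; case: pselect => [[y Cy]|?] /= A'c Ax; last exact: A'c.
  by have [_ /(_ _ Ax) xy _] := CP _ Cy; exact: lt_trans xy (Cc _ Cy).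
move: B'c; rewrite /B'; case: pselect => [[y Dy]|?] /= B'c Bx; last exact: B'c.
by have [_ _ /(_ _ Bx) yx] := DP _ Dy; exact: lt_trans (Dc _ Dy) yx.
Qed.

Lemma saturated_interval d (T : orderType d) (P : set T) x y :
  saturated K P -> P x -> P y -> x < y ->
  saturated K [set c | [/\ P c, x < c & c < y]].
Proof.
move=> satP Px Py xy.
have fin (z : T) : card_lt [set z] [set: K] by exact: finite_card_lt.
have := saturated_gap satP (_ : [set x] `<=` P) (_ : [set y] `<=` P) (fin x) (fin y).
have -> : [set c | [/\ P c, forall a, [set x] a -> a < c
                    & forall b, [set y] b -> c < b]] =
    [set c | [/\ P c, x < c & c < y]].
  apply/seteqP; split=> c [Pc xc cy]; split; rewrite ?xc ?cy //.
    by move=> _ ->.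
  by move=> _ ->.
by apply=> [_ -> //|_ -> //|_ _ -> ->].
Qed.

Lemma saturated_lt d (T : orderType d) (P : set T) :
  saturated K P -> exists x y, [/\ P x, P y & x < y].
Proof.
move=> [[x Px] satP].
have [||||//|y [Py xy _]] := satP [set x] set0.
- by move=> _ ->.
- by [].
- exact: finite_card_lt.
- exact: finite_card_lt.
by exists x, y; split=> //; exact: xy.
Qed.

(** If [phi] identified no two points of [P], it would be strictly increasing there and its image
    would be saturated in [H]. *)
Lemma saturated_collapse d (T : orderType d) d' (H : orderType d') (P : set T)
    (phi : T -> H) :
  weakly_scattered K H -> (forall x y, P x -> P y -> x < y -> phi x <= phi y) ->
  saturated K P -> exists x y, [/\ P x, P y, x < y & phi x = phi y].
Proof.
move=> scH phiP satP; apply: contrapT => nex; apply: scH; exists (phi @` P).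
apply: saturated_image satP => x y Px Py xy.
rewrite lt_neqAle phiP // andbT; apply/eqP => eqphi.
by apply: nex; exists x, y.
Qed.

(** Collapsing along [tag] puts two points of [P] in one summand; the interval between them is
    saturated and stays in that summand. *)
Lemma weakly_scattered_sigma d d' (I : orderType d) (T : I -> orderType d') :
  weakly_scattered K I -> (forall i, weakly_scattered K (T i)) ->
  weakly_scattered K {i : I & T i}.
Proof.
move=> scI scT [P satP].
have tagP (x y : {i : I & T i}) : x < y -> tag x <= tag y.
  by rewrite ltEsig => /andP[].
have [x [y [Px Py xy eqxy]]] :=
  saturated_collapse (phi := tag) scI (fun x y _ _ => @tagP x y) satP.
apply: (scT (tag x)).
exists (tagged_as x @` [set c | [/\ P c, x < c & c < y]]).
apply: saturated_image (saturated_interval satP Px Py xy) => u v.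
have tagE (z : {i : I & T i}) : x < z -> z < y -> tag z = tag x.
  by move=> /tagP xz /tagP zy; apply/le_anti; rewrite xz eqxy zy.
move=> [_ /tagE xu /xu eu] [_ /tagE xv /xv ev].
move: x eu ev {Px xy eqxy tagE xu xv}.
move=> [i x]; case: u => k u; case: v => j v /= ki ji; subst k j.
by rewrite ltEsig /= lexx !tagged_asE.
Qed.

Lemma weakly_scattered_lexfun di dh (I : orderType di) (H : orderType dh)
    (wfI : well_founded (fun i j : I => i < j)) :
  card_lt [set: I] [set: K] -> weakly_scattered K H ->
  weakly_scattered K (lexfun H wfI).
Proof.
move=> ltI scH [P satP].
have [x0 Px0] := satP.1.
pose gap (A : set I) (g : I -> lexfun H wfI * lexfun H wfI) :=
  [set c | P c /\ forall j, A j -> (g j).1 < c < (g j).2].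
(* Stage [i] picks, inside all earlier intervals, two ends with the same coordinate [i]. *)
pose nested i (g : I -> lexfun H wfI * lexfun H wfI) p :=
  [/\ gap [set j | j < i] g p.1, gap [set j | j < i] g p.2,
     p.1 < p.2 & p.1 i = p.2 i].
(* The gap lies between the left ends and the right ends. Both sets are small, being indexed by a
   part of [I], and nestedness puts every left end before every right end. *)
have satgap A g : (forall i, A i -> nested i g (g i)) -> saturated K (gap A g).
  move=> gA.
  have cardA (f : I -> lexfun H wfI) : card_lt (f @` A) [set: K].
    exact/card_lt_image/(card_le_lt_trans (subset_card_le (@subsetT _ A))).
  have := saturated_gap satP (_ : (fun j => (g j).1) @` A `<=` P)
    (_ : (fun j => (g j).2) @` A `<=` P) (cardA _) (cardA _).
  have -> : [set c | [/\ P c, forall a, [set (g j).1 | j in A] a -> a < c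
      & forall b, [set (g j).2 | j in A] b -> c < b]] = gap A g.
    apply/seteqP; split => c /=.
      by move=> [Pc gc cg]; split=> // j Aj; rewrite gc ?cg //; exists j.
    by move=> [Pc gc]; split=> // _ [j /gc /andP[? ?] <-].
  apply=> [_ [j /gA[[]] + _ _ _ _ <-]|_ [j /gA[_ []] + _ _ _ <-]|] //.
  move=> _ _ [j /gA[[_ gj1] _ gj _] <-] [k /gA[_ [_ gk2] _ _] <-].
  have [jk|kj|<- //] := ltgtP j k; first by have /andP[] := gk2 j jk.
  by have /andP[] := gj1 k kj.
(* The ends of the [i]-th interval agree at [i] by choice and below [i] by induction, as they lie in
   the earlier intervals; the sandwich then pins [c]. *)
have agree g i c : (forall j, j <= i -> nested j g (g j)) ->
    (g i).1 < c < (g i).2 -> c i = (g i).1 i.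
  elim/(well_founded_ind wfI): i c => i IH c gi /andP[g1c cg2].
  have [[_ g1] [_ g2] _ g12] := gi i (lexx i).
  apply: (lexfun_sandwich g1c cg2) (lexx i) => j.
  rewrite le_eqVlt => /predU1P[-> //|ji].
  have gj k : k <= j -> nested k g (g k).
    by move=> kj; exact: gi (le_trans kj (ltW ji)).
  by rewrite (IH j ji _ gj (g1 j ji)) (IH j ji _ gj (g2 j ji)).
have [||g gP] := @transfinite_choice I _ (fun j i => j < i) nested (x0, x0) wfI.
- move=> i g g' [x y] gg' [[Px gx] [Py gy] xy xyi].
  by split=> //; split=> // j ji; rewrite -gg' //; [exact: gx | exact: gy].
- move=> i g IH.
  have IHle j k : j < i -> k <= j -> nested k g (g k).
    by move=> ji kj; exact: IH (le_lt_trans kj ji).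
  (* Points of the gap agree below [i], so coordinate [i] is monotone on it and collapsing yields
     the next pair of ends. *)
  have mono (x y : lexfun H wfI) :
      gap [set j | j < i] g x -> gap [set j | j < i] g y ->
      x < y -> x i <= y i.
    move=> [_ gx] [_ gy]; apply: lexfun_lt_coord => j ji.
    rewrite (agree g j x (IHle j ^~ ji) (gx j ji)).
    by rewrite (agree g j y (IHle j ^~ ji) (gy j ji)).
  have [x [y [gx gy xy xyi]]] :=
    saturated_collapse (phi := fun x : lexfun H wfI => x i) scH mono (satgap _ _ IH).
  by exists (x, y).
(* After all stages two distinct points remain, although every coordinate is pinned. *)
have [x [y [[_ gx] [_ gy] xy]]] := saturated_lt (satgap setT g (fun i _ => gP i)).
have xyE : x = y.
  apply/funext => i; rewrite (agree g i x (fun j _ => gP j)) ?gx //.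
  by rewrite (agree g i y (fun j _ => gP j)) ?gy.
by rewrite xyE ltxx in xy.
Qed.

End saturated.

(** * Pairs, homogeneous sets and their transfer along embeddings *)

Lemma card_setU1_II T (A : set T) n x :
  ~ A x -> A #= `I_n -> x |` A #= `I_n.+1.
Proof.
move=> nAx /card_set_bijP[f [fA fI fS]]; apply/card_set_bijP.
have neq y : A y -> y <> x by move=> Ay yx; apply: nAx; rewrite -yx.
exists (fun y => if pselect (y = x) then n else f y); split.
- by move=> y; case: pselect => /= [? _ //|? [//|/fA /ltnW]].
- move=> y z /set_mem yA /set_mem zA.
  case: pselect => /= [->|/= yx]; case: pselect => /= [->|zx] //.
  + by case: zA => [//|/fA] /= /[swap] <-; rewrite ltnn.
  + by case: yA => [//|/fA] /= /[swap] ->; rewrite ltnn.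
  + by case: yA zA => // Ay [] // Az; apply: fI; exact/mem_set.
- move=> m /=; rewrite ltnS leq_eqVlt => /predU1P[->|/fS [y Ay <-]].
    by exists x; [left | case: pselect].
  by exists y; [right | case: pselect => //= yx; case: (neq y Ay)].
Qed.

Lemma card_II2_set2 T (p : set T) :
  p #= `I_2 -> exists x y, x <> y /\ p = [set x; y].
Proof.
move=> /card_set_bijP[f [fp fI fS]].
have [[x px fx] [y py fy]] := (fS 0 isT, fS 1 isT).
exists x, y; split; first by move=> xy; rewrite xy fy in fx.
apply/seteqP; split=> [z pz|z [] -> //].
have := fp z pz; case fz : (f z) => [|[|//]] _; [left | right].
  by apply: fI; rewrite ?fx ?fz //; exact/mem_set.
by apply: fI; rewrite ?fy ?fz //; exact/mem_set.
Qed.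

Lemma homo_lt_inj d (T : orderType d) d' (P : orderType d') (v : T -> P) :
  {homo v : x y / x < y} -> injective v.
Proof. by move=> /le_mono/inc_inj. Qed.

Lemma has_order_type_image d (T : orderType d) d' (P : orderType d')
    d'' (F : orderType d'') (v : T -> P) (Q : set T) :
  {homo v : x y / x < y} -> has_order_type F Q -> has_order_type F (v @` Q).
Proof.
move=> vlt [g [[gQ gI gS] gmono]]; exists (v \o g); split; last first.
  by move=> x y /=; rewrite (leW_mono (le_mono vlt)) gmono.
split=> [x _|x y xT yT /(homo_lt_inj vlt)|_ [x Qx <-]].
- by exists (g x) => //; exact: gQ.
- exact: gI.
- by have [y _ <-] := gS x Qx; exists y.
Qed.

Lemma has_order_type_range d (T : orderType d) d' (P : orderType d') (v : T -> P) :
  {homo v : x y / x < y} -> has_order_type T (range v).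
Proof.
move=> vlt; apply: has_order_type_image => //; exists id; split=> //.
by split=> // x _; exists x.
Qed.

Lemma pair_image_proof T P (v : T -> P) (vI : injective v) (p : pairs T) :
  v @` sval p #= `I_2.
Proof.
apply: card_eq_trans (svalP p); apply: inj_card_eq => x y _ _; exact: vI.
Qed.

Definition pair_image T P (v : T -> P) (vI : injective v) (p : pairs T) : pairs P :=
  exist _ (v @` sval p) (pair_image_proof vI p).

Lemma homogeneous_image T P (v : T -> P) (vI : injective v) (f : pairs P -> bool)
    (Q : set T) i :
  homogeneous (f \o pair_image vI) Q i -> homogeneous f (v @` Q) i.
Proof.
move=> fQ p pQ; pose p0 := Q `&` v @^-1` sval p.
have vp0 : v @` p0 = sval p.
  apply/seteqP; split=> [_ [x [_ px] <-] //|y /[dup] /pQ [x Qx <-] px].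
  by exists x.
have cp0 : p0 #= `I_2.
  rewrite -(card_eql (A := v @` p0)) ?vp0; first exact: svalP p.
  by rewrite -vp0; apply: inj_card_eq => x y _ _; exact: vI.
rewrite -(fQ (exist _ p0 cp0)) /=; last by move=> x [].
by congr (f _); exact: val_inj.
Qed.

(** [arrow] ranges over all copies of the order; the induction colours [T] itself, and
    [self_arrow_arrow] converts at the end. *)
Definition self_arrow d (T : orderType d) d' (F : orderType d') (n : nat) : Prop :=
  forall f : pairs T -> bool,
    (exists Q : set T, has_order_type F Q /\ homogeneous f Q false) \/
    (exists Q : set T, Q #= `I_n /\ homogeneous f Q true).

(** The 1-homogeneous set is located inside [range v], so that a vertex joined to all of [range v]
    can be added to it. *)
Lemma self_arrow_range d (T : orderType d) d' (P : orderType d')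
    d'' (F : orderType d'') n (v : T -> P) (f : pairs P -> bool) :
  {homo v : x y / x < y} -> self_arrow T F n ->
  (exists Q, has_order_type F Q /\ homogeneous f Q false) \/
  (exists Q, [/\ Q `<=` range v, Q #= `I_n & homogeneous f Q true]).
Proof.
move=> vlt /(_ (f \o pair_image (homo_lt_inj vlt))) [] [Q [FQ hQ]]; [left|right];
  exists (v @` Q).
  by split; [exact: has_order_type_image | exact: homogeneous_image hQ].
split; [exact: image_subset | | exact: homogeneous_image hQ].
by apply: card_eq_trans FQ; apply: inj_card_eq => x y _ _; exact: homo_lt_inj.
Qed.

Lemma self_arrow_arrow d (T : orderType d) d' (P : orderType d')
    d'' (F : orderType d'') n (v : T -> P) :
  {homo v : x y / x < y} -> self_arrow T F n -> arrow P F n.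
Proof.
move=> vlt TF d0 S [g [_ gmono]] f.
have gvlt : {homo g \o v : x y / x < y} by move=> x y /vlt; rewrite -gmono.
have [|[Q [_ cQ hQ]]] := self_arrow_range f gvlt TF; first by left.
by right; exists Q.
Qed.

(** * One step of the tower: a sum of lexicographic powers *)

Section tower.
Context (d dw : Order.disp_t) (H : orderType d) (W : orderType dw).
Context (wfW : well_founded (fun v w : W => v < w)).

Definition branches (w : W) : orderType d :=
  lexfun H (suborder_wf (P := fun v => v < w) wfW).

(** With [e] numbering [H], the summand at [h] has one coordinate for each element of [W] below
    [e h]: room to avoid one point for every [h'] with a smaller number. *)
Definition comb (e : H -> W) : orderType d := {h : H & branches (e h)}.

Context (e : H -> W) (e_inj : injective e).
Let T := comb e.

Let elt h (t : branches (e h)) : T := Tagged (fun h => branches (e h)) t.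

Let lt_elt h (s t : branches (e h)) : (elt s < elt t) = (s < t).
Proof. exact: (@lt_Taggedl _ _ H (fun h => branches (e h)) (elt t) s). Qed.

Let lt_tag (x y : T) : tag x < tag y -> x < y.
Proof.
move=> xy; suff : x < y :> {h : H & branches (e h)} by [].
by rewrite ltEsig (ltW xy) leNgt xy.
Qed.

(** For [A] the graph of colour 1, the first case gains a vertex and the second gives a
    0-homogeneous copy of [H]. *)
Lemma comb_ramsey (A : T -> T -> Prop) :
  (forall x y, A x y -> A y x) ->
  (exists x (u : H -> T), {homo u : h k / h < k} /\ forall h, A x (u h)) \/
  (exists z : H -> T, {homo z : h k / h < k} /\
    forall h k, h <> k -> ~ A (z h) (z k)).
Proof.
move=> Asym; have [|nA] := pselect (exists x (u : H -> T),
  {homo u : h k / h < k} /\ forall h, A x (u h)); [by left | right].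
(* An element of [H] is needed for the default value [elt s0] of the recursion. *)
have [[h0 _]|noH] := pselect (exists h : H, True); last first.
  have nH (h : H) : False by apply: noH; exists h.
  by exists (fun h => False_rect _ (nH h)); split=> [h|h]; case: (nH h).
(* The branch [t] escapes the neighbours of [z h'] by its choice at coordinate [e h']. *)
have node h (z : H -> T) : exists t : branches (e h),
    forall h', e h' < e h -> ~ A (z h') (elt t).
  pose I := suborder (fun v : W => v < e h).
  (* The whole cone over child [x] of the node given by [t] below [v] misses the neighbours of the
     [z h'] numbered [v]. *)
  pose Q (v : I) (t : I -> H) x := forall h', e h' = val v ->
    forall s : branches (e h), (forall w : I, w < v -> s w = t w) -> s v = x ->
    ~ A (z h') (elt s).
  have [|||t tQ] := @transfinite_choice I H (fun v w => v < w) Q h.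
  - exact: suborder_wf.
  - move=> v t t' x tt' Qx h' h'v s st; apply: Qx => // w wv.
    by rewrite st // tt'.
  - move=> v t _.
    have [[k kv]|nk] := pselect (exists k, e k = val v); last first.
      by exists h => k kv; case: nk; exists k.
    (* If no child works, each child [x] has a branch [s x] through it adjacent to [z k]. These
       branches first differ at [v], so they form a copy of [H] among the neighbours of one
       point. *)
    apply: contrapT => nQ; apply: nA.
    have /choice[s sP] x : exists s : branches (e h),
        [/\ forall w : I, w < v -> s w = t w, s v = x & A (z k) (elt s)].
      apply: contrapT => ns; apply: nQ; exists x => h'; rewrite -kv => /e_inj ->.
      by move=> s st sx As; apply: ns; exists s.
    exists (z k), (fun x => elt (s x)); split=> [x y xy|x]; last by have [] := sP x.
    have [sxt sxv _] := sP x; have [syt syv _] := sP y.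
    rewrite lt_elt; apply/lexfun_ltP; exists v; split=> [w wv|].
      by rewrite sxt // syt.
    by rewrite sxv syv.
  exists t => h' h'h; exact: (tQ (exist _ (e h') h'h) h').
pose s0 : branches (e h0) := (fun=> h0) : suborder (fun v => v < e h0) -> H.
(* The recursion follows the numbering [e], but [z h] is taken in summand [h], which makes [z]
   increasing on [H]. *)
have [|||z zP] := @transfinite_choice H T (fun h k => e h < e k)
  (fun h z x => tag x = h /\ forall h', e h' < e h -> ~ A (z h') x)
  (elt s0).
- exact: (@wf_inverse_image H W _ e wfW).
- move=> h z z' x zz' [tx nAx]; split=> // h' h'h; rewrite -zz' //; exact: nAx.
- by move=> h z _; have [t tP] := node h z; exists (elt t).
exists z; split=> [h k hk|h k hk].
  by apply: lt_tag; rewrite !(zP _).1.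
(* Of two points, the one with the larger number was chosen to avoid the other. *)
have : e h != e k by apply/eqP => /e_inj.
rewrite neq_lt => /orP[] lte; first exact: (zP k).2.
by move=> /Asym; exact: (zP h).2.
Qed.
(** A 1-homogeneous set of size [n] among the neighbours of [x] grows by [x]; an independent copy of
    [H] contains one of [F] through [v]. *)
Lemma comb_arrow_succ d' (F : orderType d') (v : F -> H) n :
  {homo v : x y / x < y} -> self_arrow H F n -> self_arrow T F n.+1.
Proof.
move=> vlt HF f; pose A x y := exists p : pairs T, sval p = [set x; y] /\ f p = true.
have Asym x y : A x y -> A y x by move=> [p [pxy fp]]; exists p; rewrite setUC.
have Axx x : ~ A x x.
  move=> [p [pxx _]]; have [a [b [ab pab]]] := card_II2_set2 (svalP p).
  have pE c : sval p c -> c = x by rewrite pxx => -[].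
  have [pa pb] : sval p a /\ sval p b by rewrite pab; split; [left | right].
  by apply: ab; rewrite (pE a pa) (pE b pb).
have fA (p : pairs T) x y : sval p = [set x; y] -> A x y -> f p = true.
  by move=> pxy [q [qxy <-]]; congr (f _); apply: val_inj => /=; rewrite pxy.
have [[x [u [ult Axu]]]|[z [zlt nAz]]] := comb_ramsey Asym.
  have [?|[Q [Qu cQ hQ]]] := self_arrow_range f ult HF; [by left | right].
  have AxQ y : Q y -> A x y by move=> /Qu [h _ <-]; exact: Axu.
  exists (x |` Q); split; first by apply: card_setU1_II => // /AxQ /Axx.
  move=> p pQ; have [a [b [ab pab]]] := card_II2_set2 (svalP p).
  have [pa pb] : sval p a /\ sval p b by rewrite pab; split; [left | right].
  have [ax|Qa] := pQ _ pa; have [bx|Qb] := pQ _ pb.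
  - by case: ab; rewrite ax bx.
  - by apply: fA pab _; rewrite ax; exact: AxQ.
  - by apply: fA pab _; apply: Asym; rewrite bx; exact: AxQ.
  - by apply: hQ; rewrite pab => _ [] ->.
have zvlt : {homo z \o v : x y / x < y} by move=> x y /vlt /zlt.
left; exists (range (z \o v)); split; first exact: has_order_type_range.
move=> p pz; have [a [b [ab pab]]] := card_II2_set2 (svalP p).
have [[a' _ aE] [b' _ bE]] : range (z \o v) a /\ range (z \o v) b.
  by split; apply: pz; rewrite pab; [left | right].
apply/negbTE/negP => fp; apply: (nAz (v a') (v b')); last first.
  by exists p; rewrite [z _]aE [z _]bE.
by move=> ab'; apply: ab; rewrite -aE -bE /= ab'.
Qed.

Lemma comb_embedding : exists v : H -> T, {homo v : x y / x < y}.
Proof.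
exists (fun h => elt ((fun=> h) : suborder (fun v => v < e h) -> H)) => h k hk.
exact: lt_tag.
Qed.

End tower.

(** * The tower and its sum *)

Lemma weakly_scattered_nat (K : Type) :
  infinite_set [set: K] -> weakly_scattered K nat.
Proof.
move=> infK [P satP]; have [x [y [Px Py xy]]] := saturated_lt infK satP.
(* Infinite descent on the right end of an interval. *)
elim/ltn_ind: y => y IH in Py xy *.
have [[z [Pz xz zy]] _] := saturated_interval infK satP Px Py xy.
exact: IH zy Pz xz.
Qed.

Lemma card_le_sigma (K I : Type) (T : I -> Type) :
  [set: K * K] #<= [set: K] -> [set: I] #<= [set: K] ->
  (forall i, [set: T i] #<= [set: K]) -> [set: {i : I & T i}] #<= [set: K].
Proof.
move=> KK /card_leT_inj[f fI] leT.
have /all_sig[g gI] i : {g : T i -> K | injective g} by exact/cid/card_leT_inj.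
apply: card_le_trans KK.
apply: (@inj_card_leT _ _ (fun x => (f (projT1 x), g _ (projT2 x)))).
by move=> [i x] [j y] [/fI /= ij]; case: _ / ij in y * => /gI ->.
Qed.

Theorem theorem3p1 (K : Type) (K_infinite : infinite_set [set: K])
    (K_weak_power : is_weak_power K K)
    (d : Order.disp_t) (F : orderType d)
    (F_scattered : weakly_scattered K F)
    (F_size : [set: F] #<= [set: K]) :
  exists (d' : Order.disp_t) (T : orderType d'),
    [/\ weakly_scattered K T,
        [set: T] #<= [set: K] &
        forall n : nat, arrow T F n].
Proof.
have [powK _] := K_weak_power.
have KK : [set: K * K] #<= [set: K].
  (* The square is the power with exponent [bool], which is finite and so smaller than [K]. *)
  have ltb : card_lt [set: bool] [set: K] by exact: finite_card_lt.
  apply: card_le_trans (powK _ ltb).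
  apply: (@inj_card_leT _ _ (fun x b => if b then x.1 else x.2)).
  move=> [x1 x2] [y1 y2] /= eqxy.
  by rewrite (congr1 (@^~ true) eqxy) (congr1 (@^~ false) eqxy).
have [dw [W [wfW leKW ltW]]] := initial_well_order K.
(* The embedding of [F] is carried along because it turns an independent copy of a stage into a copy
   of [F]. *)
have tower n : exists T : orderType d,
  [/\ weakly_scattered K T, [set: T] #<= [set: K],
    exists v : F -> T, {homo v : x y / x < y} & self_arrow T F n].
  elim: n => [|n [H [scH leHK [v vlt] HF]]].
    (* [F] starts the tower, as the empty set is 1-homogeneous of size 0. *)
    exists F; split=> //; first by exists id.
    move=> f; right; exists set0; split=> [|p p0]; first by rewrite II0 card_eq00.
    have [x [y [_ pxy]]] := card_II2_set2 (svalP p).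
    by have /p0 : sval p x by rewrite pxy; left.
  have [e eI] := card_leT_inj (card_le_trans leHK leKW).
  have ltI w : card_lt [set: suborder (fun v : W => v < w)] [set: K].
    exact/card_lt_sig/ltW.
  exists (comb wfW e); split.
  - apply: (weakly_scattered_sigma K_infinite scH) => h.
    exact: (weakly_scattered_lexfun K_infinite (ltI (e h)) scH).
  (* Each summand embeds in a power of [K] with exponent smaller than [K], which has size at most
     that of [K] by hypothesis. *)
  - apply: card_le_sigma => // h; apply: card_le_trans (powK _ (ltI (e h))).
    have [i iI] := card_leT_inj leHK.
    apply: (@inj_card_leT _ _ (fun t v => i (t v))) => s t st.
    by apply/funext => v'; apply: iI; exact: (congr1 (@^~ v') st).
  - have [u ult] := comb_embedding wfW e; exists (u \o v) => x y /vlt; exact: ult.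
  - exact: comb_arrow_succ vlt HF.
have [T TP] := choice tower.
(* The sum contains every stage, so one order serves all [n]. *)
exists d, {n : nat & T n}; split.
- apply: (weakly_scattered_sigma K_infinite); first exact: weakly_scattered_nat.
  by move=> n; have [] := TP n.
- apply: card_le_sigma => //; first exact/infiniteP.
  by move=> n; have [] := TP n.
- move=> n; have [_ _ _ TF] := TP n.
  apply: self_arrow_arrow (fun x => Tagged T x) _ TF => x y xy.
  by rewrite (@lt_Taggedl _ _ nat T (Tagged T y) x).
Qed.
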